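(* Let $(\mathcal{K},\nu)$ be a finite free $\mathbb{Z}_2$-simplicial complex. Then there is a finite, simple, connected, undirected graph $G$ such that its neighborhood complex $N(G)$ is homotopy equivalent to $\mathcal{K}$.
   Context: A simplicial complex is a finite hereditary set system; it is identified with its geometric realization when topological notions are used. A $\mathbb{Z}_2$-simplicial complex $(\mathcal{K},\nu)$ is a simplicial complex $\mathcal K$ with a simplicial map $\nu:\mathcal{K}\to\mathcal{K}$ satisfying $\nu\circ\nu=\mathrm{id}$; it is free if the induced involution on the geometric realization has no fixed point. For a graph $G$ with vertex set $V(G)$ and edge set $E(G)$, and $S\subseteq V(G)$, put $\mathrm{CN}(S)=\{v\in V(G):\{s,v\}\in E(G)\text{ for all }s\in S\}$. The neighborhood complex is $N(G)=\{S\subseteq V(G):\mathrm{CN}(S)\neq\emptyset\}$.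
   Formalization: The graph G is asserted to be connected only when the orbit space of K under ν is connected (in particular when K is connected); without this the claim fails, e.g. for four isolated points swapped in two pairs, since N(G) of a connected graph has at most two components. *)

(* Defs.v *)
From HB Require Import structures.
From mathcomp Require Import all_boot all_order all_algebra.
From mathcomp Require Import all_classical all_reals all_analysis.

Set Implicit Arguments.
Unset Strict Implicit.
Unset Printing Implicit Defensive.

Import Order.TTheory GRing.Theory Num.Theory.
Import numFieldNormedType.Exports.
Local Open Scope ring_scope.

(* The ground type [T] may contain elements that are not vertices of [K]; they
   play no role.  Neither [set0 \in K] nor [K != set0] is required: the void
   complex and [[set set0]] both have empty realization. *)
Definition simplicial_complex (T : finType) (K : {set {set T}}) : Prop :=
  forall A B : {set T}, A \in K -> B \subset A -> B \in K.

Definition vertices (T : finType) (K : {set {set T}}) : {set T} :=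
  [set v | [set v] \in K].

Definition simplicial_map (T T' : finType)
    (K : {set {set T}}) (K' : {set {set T'}}) (f : T -> T') : Prop :=
  forall A : {set T}, A \in K -> f @: A \in K'.

(* The values of [nu] outside [vertices K] are irrelevant. *)
Definition Z2_complex (T : finType) (K : {set {set T}}) (nu : T -> T) : Prop :=
  [/\ simplicial_complex K, simplicial_map K K nu
    & forall v, v \in vertices K -> nu (nu v) = v].

Definition simple_graph (V : finType) (e : rel V) : Prop :=
  symmetric e /\ irreflexive e.

Definition connected_graph (V : finType) (e : rel V) : Prop :=
  (0 < #|V|)%N /\ forall u v : V, connect e u v.

Definition CN (V : finType) (e : rel V) (S : {set V}) : {set V} :=
  [set v | [forall s in S, e s v]].

Definition neighborhood_complex (V : finType) (e : rel V) : {set {set V}} :=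
  [set S : {set V} | CN e S != finset.set0].

(* The orbit space of [K] under [nu] is connected: any two vertices of [K] are
   joined by a sequence of edges of [K] and steps [x, nu x].  It holds in
   particular when [K] is connected.  Some such condition is needed to obtain a
   connected graph, because the neighborhood complex of a connected graph has at
   most two connected components. *)
Definition orbit_connected (T : finType) (K : {set {set T}}) (nu : T -> T) :
    Prop :=
  {in vertices K &, forall u v : T,
     connect (fun x y => ([set x; y] \in K) || (y == nu x)) u v}.

(* Points of the geometric realization are given by their barycentric
   coordinates; [{ptws T -> R}] carries the product topology of [R ^ T]. *)
Definition realization_points (R : realType) (T : finType) (K : {set {set T}}) :
    set {ptws T -> R} :=
  fun x => [/\ forall v : T, 0 <= x v, \sum_(v : T) x v = 1
             & [set v : T | x v != 0] \in K].

(* This type carries the subspace topology, which the library puts on every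
   [set_type]. *)
Definition realization (R : realType) (T : finType) (K : {set {set T}}) :
    topologicalType :=
  set_type (@realization_points R T K).

Definition realization_map (R : realType) (T T' : finType) (f : T -> T')
    (x : {ptws T -> R}) : {ptws T' -> R} :=
  fun w => \sum_(v : T | f v == w) x v.

Definition free_action (R : realType) (T : finType) (K : {set {set T}})
    (nu : T -> T) : Prop :=
  forall x : {ptws T -> R}, realization_points K x -> realization_map nu x <> x.

Local Open Scope classical_set_scope.

Definition homotopic (R : realType) (X Y : topologicalType) (f g : X -> Y) :
    Prop :=
  exists h : X * R -> Y,
    [/\ {within [set: X] `*` `[0, 1], continuous h},
        forall x, h (x, 0) = f x & forall x, h (x, 1) = g x].

Definition homotopy_equivalent (R : realType) (X Y : topologicalType) : Prop :=
  exists (f : X -> Y) (g : Y -> X),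
    [/\ continuous f, continuous g,
        homotopic R (g \o f) (@id X) & homotopic R (f \o g) (@id Y)].

(* Main.v *)
Require Import Defs.
From mathcomp Require Import all_boot all_order all_algebra.
From mathcomp Require Import all_classical all_reals all_analysis.

(* Finite sets, not classical ones, are meant by [set0], [subsetP] and so on. *)
Import fintype boot.finset.

(** The vertices of the graph are the nonempty simplices of [K], and [p] is
    adjacent to [q] when [p] and [nu q] are comparable for inclusion (nested).
    Adjacency is symmetric because [nu] is an involution, and irreflexive since
    [p] and [nu p] have the same size, so that comparability would make them
    equal and [nu] would fix the barycenter of [p]. A set [S] of simplices has
    the common neighbour [q] when [nu q] is comparable to all elements of [S].
    Hence the neighborhood complex is the complex [stars K] of the sets of
    simplices contained in the closed star of a vertex of the barycentric
    subdivision of [K]. It remains to see that [stars K] is homotopy equivalent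
    to [K], which holds for an arbitrary complex [K].

    The heart of the matter is a canonical choice, the [pivot] of a set [S] in
    [stars K], of a simplex comparable to all elements of [S]: the intersection
    of [S] if it is nonempty, and otherwise the least simplex comparable to all
    of [S], which then exists because such simplices are closed under
    intersection ([common_nested_setI]). If [S] is included in [S'] then the
    pivots of [S] and [S'] are comparable ([pivot_nested]), so the pivot maps
    flags of simplices of [stars K] to flags of simplices of [K].

    Points of a realization are turned into flags through superlevel sets. For a
    nonnegative function [x] on a finite set, [level_weight x A] is a continuous
    function of [x] that is nonzero exactly when every value of [x] on [A] is
    positive and exceeds all the values outside [A]; such sets [A] form a chain
    whose last term is the support of [x]. A point [x] of [K] goes to the
    normalised weights [p |-> level_weight x p], and a point [y] of [stars K]
    to the normalised sum of the indicator functions of the pivots of its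
    superlevel sets, weighted by [level_weight y]. For either composite, the
    supports of a point and of its image lie in a common simplex, so segments
    give homotopies to the identity ([homotopic_contiguous]): on [K], pivots of
    sets of superlevel sets stay inside the support of [x], and on [stars K],
    the pivot of the support of [y] is comparable both to the simplices in that
    support and to the superlevel sets of the image of [y] in [K]
    ([pivot_weight_nested]). *)

Set Implicit Arguments.
Unset Strict Implicit.
Unset Printing Implicit Defensive.

Import Order.TTheory GRing.Theory Num.Theory.
Import numFieldNormedType.Exports.
Local Open Scope ring_scope.
Local Open Scope set_scope.

(** * Continuous maps into a realization *)

Definition supp (R : realType) (T : finType) (x : T -> R) : {set T} :=
  [set v | x v != 0]%SET.

Section Realization.
Variables (R : realType) (T : finType) (K : {set {set T}}).

Lemma realization_coord_continuous (v : T) :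
  continuous (fun x : realization R K => val x v).
Proof.
move=> x.
apply: (@continuous_comp _ _ _ (fun y : realization R K => val y)
  (fun z : {ptws T -> R} => z v)); first exact: initial_continuous.
exact: (@proj_continuous T (fun=> R) v).
Qed.

Lemma realization_continuous (X : topologicalType) (f : X -> realization R K) :
  (forall v, continuous (fun x => val (f x) v)) -> continuous f.
Proof.
move=> cf; apply: continuous_comp_initial => x.
apply/cvg_sup => v.
exact: (@continuous_comp_initial {ptws T -> R} X R (fun z => z v)
  (fun x => val (f x)) (cf v) x).
Qed.

Lemma realizationP (x : realization R K) :
  [/\ forall v, 0 <= val x v, \sum_v val x v = 1 & supp (val x) \in K].
Proof. exact: set_valP x. Qed.

Lemma realization_supp_neq0 (x : realization R K) : supp (val x) != set0.
Proof.
have [_ sum1 _] := realizationP x; apply/eqP => supp0.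
have/eqP := oner_neq0 R; apply; rewrite -sum1 big1// => v _.
by apply/eqP; apply: contraT => xv; have := in_set0 v; rewrite -supp0 inE xv.
Qed.

(** Normalising the weights changes neither supports nor the order of the
    coordinates. Contiguity depends only on the supports, and superlevel sets
    only on the order. *)
Lemma weights_map (X : topologicalType) (w : X -> T -> R) :
  (forall x v, 0 <= w x v) -> (forall v, continuous (w^~ v)) ->
  (forall x, supp (w x) != set0) -> (forall x, supp (w x) \in K) ->
  exists f : X -> realization R K, [/\ continuous f,
    forall x, supp (val (f x)) = supp (w x) &
    forall x u v, (val (f x) u < val (f x) v) = (w x u < w x v)].
Proof.
move=> w0 cw wn0 wK.
have sum_gt0 x : 0 < \sum_u w x u.
  have [v] := set0Pn _ (wn0 x); rewrite inE => xv.
  rewrite (bigD1 v)//= ltr_pwDl ?sumr_ge0//.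
  by rewrite lt0r xv w0.
pose p x : {ptws T -> R} := fun v => w x v / \sum_u w x u.
have suppE x : supp (p x) = supp (w x).
  apply/setP => v; rewrite !inE mulf_eq0 invr_eq0 (gt_eqF (sum_gt0 x)).
  by rewrite orbF.
have pP x : realization_points K (p x).
  split=> [v||]; first by rewrite divr_ge0// ltW.
    by rewrite -mulr_suml divff// gt_eqF.
  by rewrite -[X in X \in K]/(supp (p x)) suppE.
exists (fun x => SigSub (mem_set (pP x))); split => //; last first.
  by move=> x u v; rewrite ltr_pM2r// invr_gt0.
apply: realization_continuous => v x /=.
apply: cvgM; first exact: cw.
apply: cvgV; first by rewrite gt_eqF.
apply: (@continuous_big _ _ +%R 0 xpredT (@add_continuous R^o)) => u _.
exact: cw.
Qed.

Definition clamp (t : R) : R := Num.max 0 (Num.min t 1).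

(** When the supports of [f x] and [g x] span a common simplex, the segment from
    [f x] to [g x] stays in it. Homotopies are defined for all real times, hence
    the clamping of the time to the unit interval. *)
Lemma homotopic_contiguous (X : topologicalType) (f g : X -> realization R K) :
  simplicial_complex K -> continuous f -> continuous g ->
  (forall x, supp (val (f x)) :|: supp (val (g x)) \in K) -> homotopic R f g.
Proof.
move=> Kcx cf cg fgK.
have cl0 t : 0 <= clamp t by rewrite /clamp le_max lexx.
have cl1 t : clamp t <= 1 by rewrite /clamp ge_max ler01 ge_min lexx orbT.
have clB t : 0 <= 1 - clamp t by rewrite subr_ge0.
pose p (z : X * R) : {ptws T -> R} := fun v =>
  (1 - clamp z.2) * val (f z.1) v + clamp z.2 * val (g z.1) v.
have pP z : realization_points K (p z).
  have [f0 f1 _] := realizationP (f z.1).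
  have [g0 g1 _] := realizationP (g z.1).
  split=> [v||]; first by rewrite addr_ge0// mulr_ge0.
    by rewrite big_split/= -!mulr_sumr f1 g1 !mulr1 subrK.
  apply: Kcx (fgK z.1) _; apply/subsetP => v; rewrite !inE.
  apply: contra_neqT; rewrite negb_or !negbK => /andP[/eqP fv /eqP gv].
  by rewrite /p fv gv !mulr0 addr0.
exists (fun z => SigSub (mem_set (pP z))); split.
- apply: continuous_subspaceT; apply: realization_continuous => v z /=.
  have ccl : {for z, continuous (fun z : X * R => clamp z.2)}.
    apply: (@continuous_comp _ _ _ (fun z : X * R => z.2) clamp).
      exact: cvg_snd.
    apply: (@continuous_max R R (fun=> 0) (fun t : R => Num.min t 1) z.2).
      exact: cvg_cst.
    apply: (@continuous_min R R id (fun=> 1) z.2); first exact: cvg_id.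
    exact: cvg_cst.
  have cfst (h : X -> realization R K) : continuous h ->
      {for z, continuous (fun z : X * R => val (h z.1) v)}.
    move=> ch; apply: (@continuous_comp _ _ _ (fun z : X * R => z.1)
      (fun x => val (h x) v)); first exact: cvg_fst.
    exact: (@continuous_comp _ _ _ h (fun y : realization R K => val y v) z.1
      (ch z.1) (@realization_coord_continuous v (h z.1))).
  apply: cvgD; apply: cvgM; [|exact: cfst|exact: ccl|exact: cfst].
  by apply: cvgB => //; exact: cvg_cst.
- move=> x; apply: val_inj; apply/funext => v /=.
  by rewrite /p /clamp/= min_l// maxxx subr0 mul1r mul0r addr0.
- move=> x; apply: val_inj; apply/funext => v /=.
  by rewrite /p /clamp/= minxx max_r// subrr mul1r mul0r add0r.
Qed.

End Realization.

(** * Superlevel sets *)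

Section LevelWeight.
Variables (R : realType) (E : finType).
Implicit Types (x : E -> R) (A B : {set E}).

(** For nonnegative [x], nonzero exactly when [A] is the set where [x] exceeds
    some nonnegative threshold. Writing it as a product makes it continuous in
    [x]. *)
Definition level_weight x A : R :=
  \prod_(a in A) (x a * \prod_(b in ~: A) Num.max 0 (x a - x b)).

Lemma level_weight_ge0 x A : (forall a, 0 <= x a) -> 0 <= level_weight x A.
Proof.
move=> x0; apply: prodr_ge0 => a _; rewrite mulr_ge0//.
by apply: prodr_ge0 => b _; rewrite le_max lexx.
Qed.

Lemma level_weight_neq0 x A : level_weight x A != 0 ->
  forall a, a \in A -> x a != 0 /\ forall b, b \notin A -> x b < x a.
Proof.
move=> /prodf_neq0 wA a /wA.
rewrite mulf_eq0 negb_or => /andP[xa /prodf_neq0 xab].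
split=> // b bA; have := xab b; rewrite inE => /(_ bA).
by apply: contraNT; rewrite -leNgt -subr_le0 => /max_l ->.
Qed.

Lemma level_weight_supp x : (forall a, 0 <= x a) ->
  level_weight x (supp x) != 0.
Proof.
move=> x0; apply/prodf_neq0 => a; rewrite inE => xa; rewrite mulf_neq0//.
apply/prodf_neq0 => b; rewrite !inE negbK => /eqP ->; rewrite subr0.
by rewrite max_r.
Qed.

Lemma level_weight_subset x A : level_weight x A != 0 -> A \subset supp x.
Proof.
by move=> wA; apply/subsetP => a /(level_weight_neq0 wA)[]; rewrite inE.
Qed.

Definition nested (A B : {set E}) := (A \subset B) || (B \subset A).

Lemma nestedPn A B :
  reflect (exists a b, [/\ a \in A, a \notin B, b \in B & b \notin A])
    (~~ nested A B).
Proof.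
rewrite negb_or; apply: (iffP andP) => [[]|].
  by move=> /subsetPn[a aA aB] /subsetPn[b bB bA]; exists a, b.
by move=> [a [b [aA aB bB bA]]]; split; apply/subsetPn; [exists a|exists b].
Qed.

(** Superlevel sets of the same function form a chain. *)
Lemma level_weight_nested x A B :
  level_weight x A != 0 -> level_weight x B != 0 -> nested A B.
Proof.
move=> wA wB; apply/negPn/nestedPn => -[a [b [aA aB bB bA]]].
have [_ /(_ b bA)] := level_weight_neq0 wA aA.
by have [_ /(_ a aB) /lt_trans h /h] := level_weight_neq0 wB bB; rewrite ltxx.
Qed.

Lemma level_weight_continuous (X : topologicalType) (x : X -> E -> R) A :
  (forall a, continuous (x^~ a)) -> continuous (fun y => level_weight (x y) A).
Proof.
move=> cx; apply: (@continuous_big R E *%R 1 _ (@mul_continuous R)) => a _ y.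
apply: cvgM; first exact: cx.
move: y; apply: (@continuous_big R E *%R 1 _ (@mul_continuous R)) => b _ y.
apply: (@continuous_max R X (fun=> 0) (fun y => x y a - x y b) y).
  exact: cvg_cst.
by apply: cvgB; exact: cx.
Qed.

End LevelWeight.

(** * The complex of simplices with a common neighbour *)

Notation simplex K := {A : {set _} | (A \in K) && (A != set0)}.

Section Stars.
Variables (T : finType) (K : {set {set T}}).
Hypothesis Kcx : simplicial_complex K.
Implicit Types (S : {set simplex K}) (p s : simplex K).

(** The simplices comparable to all of [S]: the vertices of the barycentric
    subdivision whose closed star contains [S]. *)
Definition common_nested S : {set simplex K} :=
  [set p | [forall s in S, nested (val s) (val p)]].

Definition stars : {set {set simplex K}} := [set S | common_nested S != set0].

Lemma common_nestedP S p :
  reflect (forall s, s \in S -> nested (val s) (val p)) (p \in common_nested S).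
Proof. by rewrite inE; exact: forall_inP. Qed.

Lemma simplexP p : val p \in K /\ val p != set0.
Proof. exact/andP/(valP p). Qed.

Lemma simplex_intro (A : {set T}) : A \in K -> A != set0 ->
  exists p : simplex K, val p = A.
Proof.
move=> AK A0; have Ap : (A \in K) && (A != set0) by rewrite AK.
by exists (exist (fun A : {set T} => (A \in K) && (A != set0)) A Ap).
Qed.

Definition core S : {set T} := \bigcap_(s in S) val s.

(** When [core S] is empty, the second intersection is itself comparable to all
    of [S], hence the least such simplex ([pivotP]). *)
Definition pivot S : {set T} :=
  if core S != set0 then core S else \bigcap_(p in common_nested S) val p.

Lemma core_sub S s : s \in S -> core S \subset val s.
Proof. by move=> sS; exact: bigcap_inf. Qed.

(** If [s] contains [p] or [p'] then it contains their intersection, and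
    otherwise it lies in both. The emptiness of [core S] makes the intersection
    nonempty. *)
Lemma common_nested_setI S p p' : core S = set0 ->
  p \in common_nested S -> p' \in common_nested S ->
  exists2 r, r \in common_nested S & val r = val p :&: val p'.
Proof.
move=> S0 /common_nestedP pS /common_nestedP p'S.
have nS s : s \in S -> nested (val s) (val p :&: val p').
  move=> sS; have := pS s sS; have := p'S s sS; rewrite /nested subsetI.
  case/orP => [->|sp'] /=; last first.
    by rewrite (subset_trans (subsetIr _ _) sp') orbT.
  by case/orP => [->//|sp]; rewrite (subset_trans (subsetIl _ _) sp) orbT.
have [[pK p0] [p'K p'0]] := (simplexP p, simplexP p').
suff I0 : val p :&: val p' != set0.
  have [r rE] := simplex_intro (Kcx pK (subsetIl _ _)) I0.
  by exists r => //; apply/common_nestedP; rewrite rE.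
(* If every [s] in [S] contained [p], then [p] would lie in [core S]; so some
   [s] lies strictly inside [p], and it or [p'] sits in the intersection. *)
have [s sS psN] : exists2 s, s \in S & ~~ (val p \subset val s).
  apply/exists_inP; apply: contraT; rewrite negb_exists_in => /forall_inP h.
  have /subset_neq0/(_ p0) : val p \subset core S.
    by apply/bigcapsP => s sS; exact/negPn/h.
  by rewrite S0 eqxx.
have sp : val s \subset val p.
  by have := pS s sS; rewrite /nested (negbTE psN) orbF.
have [sp'|p's] := orP (p'S s sS).
  by apply: (subset_neq0 _ (simplexP s).2); rewrite subsetI sp.
by rewrite (setIidPr (subset_trans p's sp)).
Qed.

(** The case of an empty [core S] takes a simplex [p] of least size in the
    family: its intersection with any other member is again a member, so [p] is
    contained in all of them. *)
Lemma pivotP S : S != set0 -> S \in stars ->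
  exists2 p, p \in common_nested S & val p = pivot S.
Proof.
move=> S0; rewrite inE => /set0Pn[p0 p0S]; rewrite /pivot.
case: ifPn => [C0|/negPn/eqP C0].
  have /set0Pn[s sS] := S0.
  have [p pE] := simplex_intro (Kcx (simplexP s).1 (core_sub sS)) C0.
  exists p => //; apply/common_nestedP => t tS.
  by rewrite /nested pE (core_sub tS) orbT.
case: (@arg_minnP _ p0 (mem (common_nested S)) (fun p => #|val p|) p0S).
move=> p pS pmin.
exists p => //; apply/eqP; rewrite eqEsubset; apply/andP; split; last first.
  exact: bigcap_inf.
apply/bigcapsP => p' p'S; have [r rS rE] := common_nested_setI C0 pS p'S.
have := pmin _ rS; rewrite rE => le.
have /eqP <- : val p :&: val p' == val p by rewrite eqEcard subsetIl.
exact: subsetIr.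
Qed.

Lemma pivot_sub S p : core S = set0 -> p \in common_nested S ->
  pivot S \subset val p.
Proof. by move=> C0 pS; rewrite /pivot C0 eqxx/=; exact: bigcap_inf. Qed.

Lemma common_nested_anti S S' :
  S \subset S' -> common_nested S' \subset common_nested S.
Proof.
move=> /subsetP SS'; apply/subsetP => p /common_nestedP pS'.
by apply/common_nestedP => s /SS'; exact: pS'.
Qed.

Lemma stars_complex : simplicial_complex stars.
Proof.
move=> S' S; rewrite !inE => /set0Pn[p pS'].
move=> /common_nested_anti/subsetP/(_ p pS') pS.
by apply/set0Pn; exists p.
Qed.

(** If both cores are nonempty they are nested, and if both are empty the pivot
    of [S] is least in a larger family. If only [core S] is nonempty, the pivot
    of [S'] is comparable to every [s] in [S]: it contains some [s], hence
    [core S], or it is contained in all of them, hence in [core S]. *)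
Lemma pivot_nested S S' : S != set0 -> S \subset S' -> S' \in stars ->
  nested (pivot S) (pivot S').
Proof.
move=> S0 SS' S'st.
have S'0 := subset_neq0 SS' S0.
have [p pS' pE] := pivotP S'0 S'st.
have /common_nestedP pS := subsetP (common_nested_anti SS') _ pS'.
have CC' : core S' \subset core S.
  by apply/bigcapsP => s /(subsetP SS'); exact: core_sub.
have [C'0|C'0] := eqVneq (core S') set0; last first.
  have C0 := subset_neq0 CC' C'0.
  by rewrite /pivot C'0 C0 /nested CC' orbT.
have [C0|C0] := eqVneq (core S) set0.
  by rewrite /nested -pE pivot_sub//; exact/common_nestedP.
rewrite -pE {1}/pivot C0 /nested.
have [/exists_inP[s sS sp]|] := boolP [exists s in S, val s \subset val p].
  by rewrite (subset_trans (core_sub sS) sp).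
rewrite negb_exists_in => /forall_inP h; apply/orP; right.
apply/bigcapsP => s sS; have := pS s sS; rewrite /nested.
by rewrite (negbTE (h s sS)).
Qed.

End Stars.

(** * The homotopy equivalence between [stars K] and [K] *)

Section Equivalence.
Variables (R : realType) (T : finType) (K : {set {set T}}).
Hypothesis Kcx : simplicial_complex K.
Implicit Types (y : simplex K -> R) (S : {set simplex K}).

(** Up to a positive factor, the image of [y] in [K]. The empty superlevel set
    is excluded because its level weight is an empty product, equal to 1. *)
Definition pivot_weight y (v : T) : R :=
  \sum_(S | (S != set0) && (v \in pivot S)) level_weight y S.

Lemma pivot_weight_ge0 y v : (forall s, 0 <= y s) -> 0 <= pivot_weight y v.
Proof. by move=> y0; apply: sumr_ge0 => S _; exact: level_weight_ge0. Qed.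

Lemma pivot_weight_suppP y v : (forall s, 0 <= y s) ->
  reflect (exists S, [/\ S != set0, level_weight y S != 0 & v \in pivot S])
    (v \in supp (pivot_weight y)).
Proof.
move=> y0; rewrite inE psumr_neq0; last by move=> S _; exact: level_weight_ge0.
apply: (iffP hasP) => [[S _ /andP[/andP[S0 vS] wS]]|[S [S0 wS vS]]].
  by exists S; rewrite gt_eqF.
by exists S; rewrite ?mem_index_enum// S0 vS lt0r wS level_weight_ge0.
Qed.

Lemma pivot_weight_le y a b : (forall s, 0 <= y s) ->
  (forall S, S != set0 -> level_weight y S != 0 ->
     a \in pivot S -> b \in pivot S) ->
  pivot_weight y a <= pivot_weight y b.
Proof.
move=> y0 ab; rewrite /pivot_weight big_mkcond [leRHS]big_mkcond/=.
apply: ler_sum => S _; have w0 := level_weight_ge0 S y0.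
case: (eqVneq S set0) => //= S0; case: ifPn => [aS|_]; last by case: ifP.
by have [->|wS] := eqVneq (level_weight y S) 0; [case: ifP|rewrite ab].
Qed.

Lemma level_weight_stars y S :
  supp y \in stars K -> level_weight y S != 0 -> S \in stars K.
Proof. by move=> yst wS; apply: stars_complex yst (level_weight_subset wS). Qed.

Lemma pivot_weight_supp_neq0 y : (forall s, 0 <= y s) -> supp y != set0 ->
  supp y \in stars K -> supp (pivot_weight y) != set0.
Proof.
move=> y0 yn0 yst; have [p _ pE] := pivotP Kcx yn0 yst.
have /set0Pn[v vp] := (simplexP p).2; apply/set0Pn; exists v.
apply/pivot_weight_suppP => //; exists (supp y); rewrite -pE vp yn0.
by rewrite level_weight_supp.
Qed.

(** The support is the union of a chain of pivots, hence one of them. *)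
Lemma pivot_weight_supp_in y : (forall s, 0 <= y s) -> supp y != set0 ->
  supp y \in stars K -> supp (pivot_weight y) \in K.
Proof.
move=> y0 yn0 yst.
pose P S := (S != set0) && (level_weight y S != 0).
have P0 : P (supp y) by rewrite /P yn0 level_weight_supp.
case: (@arg_maxnP _ (supp y) P (fun S => #|pivot S|) P0) => S /andP[S0 wS] Smax.
have [p _ pE] := pivotP Kcx S0 (level_weight_stars yst wS).
apply: Kcx (simplexP p).1 _; rewrite pE; apply/subsetP => v.
move=> /(pivot_weight_suppP _ y0)[S' [S'0 wS' vS']].
have : nested (pivot S) (pivot S').
  have /orP[SS'|S'S] := level_weight_nested wS wS'.
    exact: pivot_nested SS' (level_weight_stars yst wS').
  rewrite /nested orbC.
  exact: pivot_nested S'S (level_weight_stars yst wS).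
case/orP => [sub|/subsetP]; last exact.
suff /eqP -> : pivot S == pivot S' by [].
by rewrite eqEcard sub; apply: Smax; rewrite /P S'0.
Qed.

(** The value at [a] sums weights over the pivots that contain [a]. If [a] is
    outside the pivot of [supp y], a pivot containing [a] is not inside the
    latter, so it contains the latter by nestedness. Hence the value at [a] is
    at most the value at any point [b] of the pivot of [supp y], and a
    superlevel set that contains [a] contains [b]. *)
Lemma pivot_weight_nested y (A : {set T}) : (forall s, 0 <= y s) ->
  supp y \in stars K ->
  (forall a b, a \in A -> b \notin A -> pivot_weight y b < pivot_weight y a) ->
  nested A (pivot (supp y)).
Proof.
move=> y0 yst Alev; apply/negPn/nestedPn => -[a [b [aA aS bS bA]]].
have := Alev a b aA bA; rewrite ltNge => /negP; apply.
apply: pivot_weight_le => // S S0 wS aP.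
have /orP[sub|/subsetP] := pivot_nested Kcx S0 (level_weight_subset wS) yst.
  by move: aS; rewrite (subsetP sub _ aP).
exact.
Qed.

Lemma pivot_weight_continuous (X : topologicalType)
    (y : X -> simplex K -> R) v :
  (forall s, continuous (y^~ s)) -> continuous (fun x => pivot_weight (y x) v).
Proof.
move=> cy; rewrite /pivot_weight.
apply: (@continuous_big R _ +%R 0 _ (@add_continuous R^o)) => S _.
exact: level_weight_continuous.
Qed.

Lemma stars_homotopy_equivalent :
  homotopy_equivalent R (realization R (stars K)) (realization R K).
Proof.
have [f [cf fsupp flt]] : exists f : realization R (stars K) -> realization R K,
    [/\ continuous f,
        forall z, supp (val (f z)) = supp (pivot_weight (val z)) &
        forall z u v, (val (f z) u < val (f z) v) =
          (pivot_weight (val z) u < pivot_weight (val z) v)].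
  apply: weights_map => [z v|v|z|z].
  - by have [z0 _ _] := realizationP z; exact: pivot_weight_ge0.
  - by apply: pivot_weight_continuous => s; exact: realization_coord_continuous.
  - have [z0 _ zst] := realizationP z.
    by apply: pivot_weight_supp_neq0 => //; exact: realization_supp_neq0.
  - have [z0 _ zst] := realizationP z.
    by apply: pivot_weight_supp_in => //; exact: realization_supp_neq0.
have suppP (x : realization R K) : exists p : simplex K, val p = supp (val x).
  have [_ _ xK] := realizationP x.
  by apply: simplex_intro => //; exact: realization_supp_neq0.
have [g [cg gsupp _]] : exists g : realization R K -> realization R (stars K),
    [/\ continuous g,
        forall x, supp (val (g x)) =
          supp (fun p : simplex K => level_weight (val x) (val p)) &
        forall x p q, (val (g x) p < val (g x) q) =
          (level_weight (val x) (val p) < level_weight (val x) (val q))].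
  apply: weights_map => [x p|p|x|x].
  - by have [x0 _ _] := realizationP x; exact: level_weight_ge0.
  - by apply: level_weight_continuous => v; exact: realization_coord_continuous.
  - have [x0 _ _] := realizationP x; have [p pE] := suppP x.
    by apply/set0Pn; exists p; rewrite inE pE level_weight_supp.
  - have [p pE] := suppP x; rewrite inE; apply/set0Pn; exists p.
    apply/common_nestedP => s; rewrite inE pE => /level_weight_subset sx.
    by rewrite /nested sx.
exists f, g; split => //.
- apply: homotopic_contiguous => [|||z].
  + exact: stars_complex.
  + by move=> z; apply: continuous_comp; [exact: cf|exact: cg].
  + by move=> z; exact: cvg_id.
  + have [z0 _ zst] := realizationP z.
    have [p /common_nestedP pl pE] := pivotP Kcx (realization_supp_neq0 z) zst.
    rewrite [_ \in stars K]inE; apply/set0Pn; exists p.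
    apply/common_nestedP => s; rewrite in_setU => /orP[|/pl//].
    rewrite /= gsupp inE => ws.
    rewrite pE; apply: pivot_weight_nested => // a b aA bA.
    by rewrite -flt; have [_ /(_ b bA)] := level_weight_neq0 ws aA.
- apply: homotopic_contiguous => [|||x] //.
  + by move=> x; apply: continuous_comp; [exact: cg|exact: cf].
  + by move=> x; exact: cvg_id.
  + have [_ _ xK] := realizationP x; have [gx0 _ _] := realizationP (g x).
    suff /setUidPr -> : supp (val (f (g x))) \subset supp (val x) by [].
    have [p pE] := suppP x; rewrite fsupp; apply/subsetP => v.
    move=> /(pivot_weight_suppP _ gx0)[S [S0 wS vS]].
    move/level_weight_subset/subsetP in wS.
    have sx s : s \in S -> val s \subset supp (val x).
      by move=> /wS; rewrite gsupp inE => /level_weight_subset.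
    apply: subsetP vS.
    have [C0|C0] := eqVneq (core S) set0.
      rewrite -pE; apply: pivot_sub => //; apply/common_nestedP => s /sx sp.
      by rewrite /nested pE sp.
    have /set0Pn[s sS] := S0.
    by rewrite /pivot C0 (subset_trans (core_sub sS) (sx s sS)).
Qed.

End Equivalence.

(** * The graph of a free involution *)

Section Graph.
Variables (R : realType) (T : finType) (K : {set {set T}}) (nu : T -> T).
Hypotheses (hK : Z2_complex K nu) (hfree : free_action R K nu).
Implicit Types (A : {set T}) (p q : simplex K).

Definition flip_edge : rel (simplex K) :=
  fun p q => nested (val p) (nu @: val q).

Lemma simplex_vertex A v : A \in K -> v \in A -> v \in vertices K.
Proof.
by case: hK => cx _ _ AK vA; rewrite inE; apply: cx AK _; rewrite sub1set.
Qed.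

Lemma flipK A : A \in K -> nu @: (nu @: A) = A.
Proof.
case: hK => _ _ nuK AK; rewrite -imset_comp -[RHS]imset_id.
by apply: eq_in_imset => v vA; apply: nuK; exact: simplex_vertex AK vA.
Qed.

Lemma flip_inj A : A \in K -> {in A &, injective nu}.
Proof.
case: hK => _ _ nuK AK u v uA vA nuv.
by rewrite -(nuK _ (simplex_vertex AK uA)) nuv nuK// (simplex_vertex AK vA).
Qed.

Lemma flip_simplex p : exists q, val q = nu @: val p.
Proof.
have [pK p0] := simplexP p; case: hK => _ nuS _.
by apply: simplex_intro; [exact: nuS|rewrite imset_eq0].
Qed.

Lemma flip_sub A B : A \in K -> B \in K ->
  (nu @: A \subset nu @: B) = (A \subset B).
Proof.
move=> AK BK; apply/idP/idP => [/(imsetS nu)|]; last exact: imsetS.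
by rewrite !flipK.
Qed.

Lemma flip_nested A B : A \in K -> B \in K ->
  nested (nu @: A) (nu @: B) = nested A B.
Proof. by move=> AK BK; rewrite /nested !flip_sub. Qed.

Lemma flip_edge_sym : symmetric flip_edge.
Proof.
move=> p q; have [[pK _] [qK _]] := (simplexP p, simplexP q).
have [q' q'E] := flip_simplex q; rewrite /flip_edge.
by rewrite -flip_nested ?flipK// -?q'E ?(simplexP q').1// /nested orbC.
Qed.

(** An invariant simplex would have a fixed barycenter. *)
Lemma flip_fixed_free A : A \in K -> A != set0 -> nu @: A != A.
Proof.
move=> AK A0; apply/eqP => nuA.
have A_gt0 : 0 < #|A|%:R :> R by rewrite ltr0n card_gt0.
pose x : {ptws T -> R} := fun v => (v \in A)%:R / #|A|%:R.
have xP : realization_points K x.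
  split=> [v||]; first by rewrite divr_ge0.
    rewrite -mulr_suml -[RHS](divff (lt0r_neq0 A_gt0)) -sum1_card natr_sum.
    congr (_ / _); rewrite [RHS]big_mkcond/=.
    by apply: eq_bigr => v _; case: ifP.
  suff -> : [set v | x v != 0] = A by [].
  apply/setP => v; rewrite inE mulf_eq0 invr_eq0 (gt_eqF A_gt0) orbF.
  by rewrite pnatr_eq0 eqb0 negbK.
apply: hfree xP _; apply/funext => w; rewrite /realization_map.
have [wA|wA] := boolP (w \in A); last first.
  rewrite /x (negbTE wA) mul0r big1// => v /eqP nuv.
  case: (boolP (v \in A)) => [vA|_]; last by rewrite mul0r.
  by move: wA; rewrite -nuA -nuv imset_f.
have := wA; rewrite -{1}nuA => /imsetP[u uA wE].
rewrite (bigD1 u) ?wE ?eqxx//= big1 => [|v /andP[/eqP nuv vu]].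
  by rewrite addr0 /x uA -wE wA.
rewrite /x; case: (boolP (v \in A)) => [vA|_]; last by rewrite mul0r.
by rewrite (flip_inj AK vA uA nuv) eqxx in vu.
Qed.

Lemma flip_edge_irr : irreflexive flip_edge.
Proof.
move=> p; have [pK p0] := simplexP p; apply/negP; rewrite /flip_edge => h.
have cE : #|nu @: val p| = #|val p| by apply: card_in_imset; exact: flip_inj.
have /negP := flip_fixed_free pK p0; apply.
by case/orP: h => h; [rewrite eq_sym|]; rewrite eqEcard h cE leqnn.
Qed.

(** The image [nu q] ranges over all simplices when [q] does. *)
Lemma neighborhood_flip_edge : neighborhood_complex flip_edge = stars K.
Proof.
apply/setP => S; rewrite !inE; apply/set0Pn/set0Pn => -[p].
  rewrite inE => /forall_inP pS; have [q qE] := flip_simplex p.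
  by exists q; apply/common_nestedP => s /pS; rewrite qE.
move=> /common_nestedP pS; have [q qE] := flip_simplex p.
exists q; rewrite inE; apply/forall_inP => s /pS.
by rewrite /flip_edge qE flipK// (simplexP p).1.
Qed.

Lemma flip_edge_flip p q : val q = nu @: val p -> flip_edge p q.
Proof.
by move=> qE; rewrite /flip_edge qE flipK ?(simplexP p).1// /nested subxx.
Qed.

(** The path goes from [p] through [nu q], which is adjacent to both. *)
Lemma connect_nested p q : nested (val p) (val q) -> connect flip_edge p q.
Proof.
move=> pq; have [r rE] := flip_simplex q.
apply: (@connect_trans _ _ r); apply: connect1; last first.
  by rewrite flip_edge_sym; exact: flip_edge_flip.
by rewrite /flip_edge rE flipK// (simplexP q).1.
Qed.

(** Every simplex is joined to its vertices. A step along an edge of [K] goes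
    through that edge, seen as a vertex of the graph, and [v] is adjacent to
    [nu v]. *)
Lemma flip_edge_connected : vertices K != set0 -> orbit_connected K nu ->
  connected_graph flip_edge.
Proof.
move=> /set0Pn[v0 v0V]; case: (hK) => cx nuS _ conn.
have vx v : v \in vertices K -> exists p : simplex K, val p = [set v].
  by rewrite inE => vK; apply: simplex_intro => //; rewrite -card_gt0 cards1.
have conn_vx u v : connect (fun x y => ([set x; y] \in K) || (y == nu x)) u v ->
    u \in vertices K -> forall p q : simplex K,
    val p = [set u] -> val q = [set v] -> connect flip_edge p q.
  move=> /connectP[s]; elim: s u => [|w s IHs] u.
    move=> _ -> _ p q pE qE.
    by have -> : p = q by apply: val_inj; exact: etrans pE (esym qE).
  rewrite [path _ _ _]/= => /andP[uw ws] vE uK p q pE qE.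
  have step : w \in vertices K /\ forall r : simplex K, val r = [set w] ->
      connect flip_edge p r.
    have [uwK|/eqP wE] := orP uw.
      split; first by apply: simplex_vertex uwK _; rewrite !inE eqxx orbT.
      move=> r rE; have [t tE] : exists t : simplex K, val t = [set u; w].
        apply: simplex_intro => //; apply/set0Pn.
        by exists u; rewrite !inE eqxx.
      apply: (@connect_trans _ _ t); apply: connect_nested.
        by rewrite /nested pE tE sub1set !inE eqxx.
      by rewrite /nested rE tE sub1set !inE eqxx !orbT.
    split; first by rewrite inE wE -imset_set1; apply: nuS; rewrite inE in uK.
    move=> r rE; apply: connect1; apply: flip_edge_flip.
    by rewrite rE pE imset_set1 wE.
  have [wK pw] := step; have [r rE] := vx w wK.
  exact: connect_trans (pw r rE) (IHs w ws vE wK r q rE qE).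
split; first by have [p _] := vx v0 v0V; apply/card_gt0P; exists p.
have toV (p : simplex K) : exists2 v, v \in vertices K &
    forall r : simplex K, val r = [set v] -> nested (val p) (val r).
  have [pK /set0Pn[v vp]] := simplexP p.
  exists v; first exact: simplex_vertex pK vp.
  by move=> r rE; rewrite /nested rE sub1set vp orbT.
move=> p q; have [u uK pu] := toV p; have [v vK qv] := toV q.
have [[p' p'E] [q' q'E]] := (vx u uK, vx v vK).
apply: (@connect_trans _ _ p'); first exact/connect_nested/pu.
apply: (@connect_trans _ _ q').
  exact: conn_vx (conn u v uK vK) uK _ _ p'E q'E.
by apply: connect_nested; rewrite /nested orbC; exact: qv.
Qed.

End Graph.

Lemma homotopy_equivalent_empty (R : realType) (X Y : topologicalType) :
  (X -> False) -> (Y -> False) -> homotopy_equivalent R X Y.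
Proof.
move=> X0 Y0.
exists (fun x => False_rect Y (X0 x)), (fun y => False_rect X (Y0 y)).
split; [by move=> x; have := X0 x|by move=> y; have := Y0 y| |].
- exists (fun z => False_rect X (X0 z.1)).
  by split=> [z|x|x]; [have := X0 z.1|have := X0 x|have := X0 x].
- exists (fun z => False_rect Y (Y0 z.1)).
  by split=> [z|x|x]; [have := Y0 z.1|have := Y0 x|have := Y0 x].
Qed.

Lemma realization_vertices_neq0 (R : realType) (T : finType)
    (K : {set {set T}}) :
  simplicial_complex K -> realization R K -> vertices K != set0.
Proof.
move=> cx x; have [_ _ xK] := realizationP x.
have /set0Pn[v vx] := realization_supp_neq0 x; apply/set0Pn; exists v.
by rewrite inE; apply: cx xK _; rewrite sub1set.
Qed.

Theorem theorem7 (R : realType) (T : finType) (K : {set {set T}}) (nu : T -> T)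
    (hK : Z2_complex K nu) (hfree : free_action R K nu) :
  exists (V : finType) (e : rel V),
    [/\ simple_graph e,
        orbit_connected K nu -> connected_graph e
      & homotopy_equivalent R (realization R (neighborhood_complex e))
          (realization R K)].
Proof.
have [cx _ _] := hK.
have [K0|K0] := eqVneq (vertices K) set0; last first.
  exists (simplex K), (@flip_edge T K nu); split.
  - by split; [exact: flip_edge_sym|exact: flip_edge_irr hfree].
  - exact: flip_edge_connected.
  - by rewrite neighborhood_flip_edge//; exact: stars_homotopy_equivalent.
(* When [K] has no vertex, both realizations are empty for a single vertex
   without edges; the empty graph would not count as connected. *)
exists unit, (fun _ _ => false); split=> [//|_|].
  by split=> [|[] []]; [rewrite card_unit|exact: connect0].
apply: homotopy_equivalent_empty => [x|x]; last first.
  by have := realization_vertices_neq0 cx x; rewrite K0 eqxx.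
have [_ _] := realizationP x; rewrite inE => /set0Pn[v].
rewrite inE => /forall_inP h.
by have /set0Pn[s /h] := realization_supp_neq0 x.
Qed.
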